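(* Let $\mathcal{H}$ be a real Hilbert space and let $f:\mathcal{H}\to\mathbb{R}\cup\{+\infty\}$ be proper, convex, lower semicontinuous with $\operatorname{argmin} f\neq\emptyset$. Let $c,\lambda>0$, and for $k\ge1$ put $\alpha_k=1-\frac{\alpha}{k^q}$, $c_k=\frac{c}{k^p}$, $\lambda_k=\lambda k^\delta$. Assume that either [$\alpha>0$, $0<q<1$, $\delta\ge0$, $q+1<p\le2$, and for $p=2$ one has $c>q(1-q)$], or [$q=1$, $p>2$, $\alpha>3$, $0\le\delta<\alpha-3$]. Let $x_0,x_1\in\mathcal H$ and let $(x_k)$ be generated by $$x_{k+1}=\operatorname{prox}_{\lambda_k f}\big(x_k+\alpha_k(x_k-x_{k-1})-c_kx_k\big),\quad k\ge1.$$ Then $(x_k)$ converges weakly to a minimizer of $f$.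
   Context: For $s>0$, $\operatorname{prox}_{sf}(x)=\operatorname{argmin}_{y\in\mathcal H}\left(f(y)+\frac{1}{2s}\|y-x\|^2\right)$. *)

(* Defs.v *)
From HB Require Import structures.
From mathcomp Require Import all_boot all_order all_algebra.
From mathcomp Require Import all_classical all_reals all_analysis.
Set Implicit Arguments.
Unset Strict Implicit.
Unset Printing Implicit Defensive.
Import Order.TTheory GRing.Theory Num.Theory.
Import numFieldNormedType.Exports.
Local Open Scope classical_set_scope.
Local Open Scope ring_scope.

(* A real Hilbert space is a complete normed space [H] together with a
   positive definite symmetric bilinear form inducing its norm. *)
Definition induces_norm (R : realType) (H : completeNormedModType R)
    (dot : {dot H for (@idfun R)}) : Prop :=
  forall x : H, `|x| ^+ 2 = dot x x.

Definition proper_fun (R : realType) (T : Type) (f : T -> \bar R) : Prop :=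
  (forall x, f x != -oo%E) /\ exists x, f x != +oo%E.

(* [convex_function] of the library only covers real-valued functions.
   Below, the product is such that [0 * +oo = 0]. *)
Definition convex_efun (R : realType) (E : lmodType R) (f : E -> \bar R)
    : Prop :=
  forall (x y : E) (t : R), 0 <= t <= 1 ->
    (f (t *: x + (1 - t) *: y)%R <= t%:E * f x + (1 - t)%:E * f y)%E.

Definition argmin (R : realType) (T : Type) (f : T -> \bar R) : set T :=
  [set x | forall y, (f x <= f y)%E].

(* The element of the argmin; it exists and is unique when [0 < s] and [f] is
   proper, convex and lower semicontinuous on a Hilbert space.  The default
   value 0 is only used outside of that setting. *)
Definition prox (R : realType) (H : completeNormedModType R) (s : R)
    (f : H -> \bar R) (x : H) : H :=
  xget 0 (argmin (fun y => (f y + ((2 * s)^-1 * `|y - x| ^+ 2)%R%:E)%E)).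

Definition weakly_converges (R : realType) (H : completeNormedModType R)
    (dot : {dot H for (@idfun R)}) (x : nat -> H) (l : H) : Prop :=
  forall y : H, dot (x n) y @[n --> \oo] --> dot l y.

(* Main.v *)
(** With [s_k = k^q], [rho_k = s_(k+1) - s_k],
    [v_k = x_k - x_(k-1)], a minimizer [z] and a well-chosen constant [b], the
    energy
      [2 s_k (s_(k+1) - alpha) lambda_k (f x_k - f z)
       + |b (x_k - z) + (s_k - alpha) v_k|^2
       + b (alpha - b - rho_k) |x_k - z|^2]
    decreases up to a summable relative error, by at least a multiple of
    [s_k |v_(k+1)|^2].  The Tikhonov term [c_k x_k] only contributes to the
    error, because [s_k c_k = c k^(q-p)] is summable when [q + 1 < p].  Hence
    the energy is bounded, so that [f x_k] tends to the minimum, and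
    [s_k |v_(k+1)|^2] is summable, from which [|x_k - z|] converges for each
    minimizer [z]; an Opial argument concludes.  The constant [b] must satisfy
    [(2 q + delta) sigma < b < alpha - q sigma], where [sigma] is the limit of
    [k^(q-1)], namely 1 if [q = 1] and 0 if [q < 1].

    In the Opial argument, weak cluster points are replaced by points lying in
    every closed convex set that eventually contains the sequence.  They exist
    because a decreasing sequence of bounded nonempty closed convex sets has a
    common point, which also provides the existence of proximal points. *)
Require Import Defs.
From HB Require Import structures.
From mathcomp Require Import all_boot all_order all_algebra.
From mathcomp Require Import all_classical all_reals all_analysis.
From mathcomp Require Import ring lra.
Set Implicit Arguments.
Unset Strict Implicit.
Unset Printing Implicit Defensive.
Import Order.TTheory GRing.Theory Num.Theory.
Import numFieldNormedType.Exports.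
Local Open Scope classical_set_scope.
Local Open Scope ring_scope.

(** * Weak limits in Hilbert spaces *)

Section Hilbert.
Context (R : realType) (H : completeNormedModType R).
Context (dot : {dot H for (@idfun R)}) (hdot : induces_norm dot).
Implicit Types u v w z : H.

Lemma dotC u v : dot u v = dot v u.
Proof. by rewrite hermC /= expr0 mul1r. Qed.

Lemma dotDl u v w : dot (u + v) w = dot u w + dot v w.
Proof. exact: linearDl. Qed.

Lemma dotZl a u w : dot (a *: u) w = a * dot u w.
Proof. by rewrite linearZl_LR. Qed.

Lemma dotNl u w : dot (- u) w = - dot u w.
Proof. exact: linearNl. Qed.

Lemma dotDr u v w : dot w (u + v) = dot w u + dot w v.
Proof. exact: linearDr. Qed.

Lemma dotZr a u w : dot w (a *: u) = a * dot w u.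
Proof. by rewrite linearZr_LR. Qed.

Lemma dotNr u w : dot w (- u) = - dot w u.
Proof. exact: linearNr. Qed.

Definition dotE := (dotDl, dotDr, dotZl, dotZr, dotNl, dotNr).

Lemma dot_norm_le u v : 2 * dot u v <= `|u| ^+ 2 + `|v| ^+ 2.
Proof.
have := sqr_ge0 `|u - v|.
by rewrite !hdot !dotE (dotC v u); lra.
Qed.

Lemma dot_ge_norm u v : - (2 * dot u v) <= `|u| ^+ 2 + `|v| ^+ 2.
Proof. by have := dot_norm_le (- u) v; rewrite normrN dotNl mulrN. Qed.

(** For the normalized vectors, [dot_norm_le] and [dot_ge_norm] bound the product between -1 and
    1. *)
Lemma cauchy_schwarz u v : `|dot u v| <= `|u| * `|v|.
Proof.
have [->|u0] := eqVneq u 0; first by rewrite linear0l !normr0 mul0r.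
have nu : 0 < `|u| by rewrite normr_gt0.
have [->|v0] := eqVneq v 0; first by rewrite linear0r !normr0 mulr0.
have nv : 0 < `|v| by rewrite normr_gt0.
have h1 := dot_norm_le (`|u|^-1 *: u) (`|v|^-1 *: v).
have h2 := dot_ge_norm (`|u|^-1 *: u) (`|v|^-1 *: v).
move: h1 h2; rewrite !normrZ !normfV !normr_id !mulVf ?gt_eqF// !dotE.
rewrite expr1n => h1 h2.
suff : `| `|u|^-1 * (`|v|^-1 * dot u v) | <= 1.
  by rewrite !normrM !normfV !normr_id ler_pdivrMl// mulr1 ler_pdivrMl// mulrC.
by rewrite ler_norml; apply/andP; split; lra.
Qed.

Lemma parallelogram u v :
  `|u + v| ^+ 2 + `|u - v| ^+ 2 = 2 * (`|u| ^+ 2 + `|v| ^+ 2).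
Proof. by rewrite !hdot !dotE (dotC v u); ring. Qed.

Lemma dot_continuous w : continuous (dot^~ w).
Proof.
move=> u; have [->|w0] := eqVneq w 0.
  have -> : dot^~ 0 = cst 0 by apply/funext => v /=; rewrite linear0r.
  exact: cvg_cst.
apply/cvgrPdist_le => e e0; have nw : 0 < `|w| by rewrite normr_gt0.
have /filterS := nbhsx_ballx u _ (divr_gt0 e0 nw); apply=> v.
rewrite -ball_normE /= ltr_pdivlMr// => /ltW le_e.
by rewrite -dotNl -dotDl; apply: le_trans le_e; exact: cauchy_schwarz.
Qed.

(* For a closed set this is convexity. *)
Definition midconvex (C : set H) :=
  forall u v, C u -> C v -> C (2^-1 *: (u + v)).

(* The elements of almost minimal norm form a Cauchy sequence, by the
   parallelogram identity applied to their midpoints. *)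
Lemma nested_closed_midconvex (C : nat -> set H) (M : R) :
  (forall n, closed (C n)) -> (forall n, midconvex (C n)) ->
  (forall n, C n.+1 `<=` C n) -> (forall n, exists2 u, C n u & `|u| <= M) ->
  exists w, forall n, C n w.
Proof.
move=> Ccl Cmid Csub Cne.
pose S n := [set `|u| ^+ 2 | u in C n]; pose r n := inf (S n).
have Clb n : lbound (S n) 0 by move=> _ [u _ <-]; exact: sqr_ge0.
have Cinf n : has_inf (S n).
  split; last by exists 0; exact: Clb.
  by have [u Cu _] := Cne n; exists (`|u| ^+ 2); exists u.
have r_le n u : C n u -> r n <= `|u| ^+ 2.
  by move=> Cu; apply: ge_inf; [by exists 0; exact: Clb|exists u].
have Cle n m : (n <= m)%N -> C m `<=` C n.
  elim: m => [|m ih]; first by rewrite leqn0 => /eqP ->.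
  by rewrite leq_eqVlt => /predU1P[->//|/ih Cmn]; apply: subset_trans Cmn.
have r_nd : {homo r : n m / (n <= m)%N >-> n <= m}.
  move=> n m nm; apply: lb_le_inf; first by case: (Cinf m).
  by move=> _ [u Cu <-]; apply: r_le; exact: (Cle _ _ nm).
have r_ub n : r n <= M ^+ 2.
  have [u Cu uM] := Cne n; apply: (le_trans (r_le _ _ Cu)).
  by rewrite lerXn2r// nnegrE// (le_trans _ uM).
have r_cvg : cvgn r.
  apply: nondecreasing_is_cvgn => //.
  by exists (M ^+ 2) => _ [n _ <-].
have /choice[p hp] n : exists u, C n u /\ `|u| ^+ 2 <= r n + n.+1%:R^-1.
  have n0 : 0 < n.+1%:R^-1 :> R by rewrite invr_gt0.
  have [_ [u Cu <-] lt_u] := inf_adherent n0 (Cinf n).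
  by exists u; split=> //; exact: ltW.
have key n m : (n <= m)%N ->
    `|p n - p m| ^+ 2 <= 2 * (r m - r n) + 4 * n.+1%:R^-1.
  move=> nm; have [Cn pn] := hp n; have [/(Cle _ _ nm) Cm pm] := hp m.
  have := r_le _ _ (Cmid _ _ _ Cn Cm); have := parallelogram (p n) (p m).
  rewrite normrZ exprMn ger0_norm ?invr_ge0// => par.
  have : m.+1%:R^-1 <= n.+1%:R^-1 :> R by rewrite lef_pV2 ?posrE// ler_nat.
  by move: pn pm par; set a := n.+1%:R^-1; set b := m.+1%:R^-1; lra.
have p_cauchy : cauchy (p @ \oo).
  apply: cauchy_exP => e e0.
  (* With both quantities below [e ^+ 2 / 8], [key] bounds the squared distance by [2/8 + 4/8] of
     [e ^+ 2]. *)
  have e2 : 0 < e ^+ 2 / 8 by rewrite divr_gt0// exprn_gt0.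
  have [N _ hN] : \forall n \near \oo,
      limn r - r n < e ^+ 2 / 8 /\ n.+1%:R^-1 < e ^+ 2 / 8.
    near=> n; split; last first.
      by near: n; exact: (near_infty_natSinv_lt (PosNum e2)).
    apply: le_lt_trans (ler_norm _) _.
    by near: n; move/cvgrPdist_lt : r_cvg; exact.
  have [rN nN] := hN _ (leqnn N).
  exists (p N); exists N => // m /= Nm; rewrite -ball_normE /=.
  rewrite -(@ltr_pXn2r _ 2%N)// ?nnegrE ?(ltW e0)//.
  apply: le_lt_trans (key _ _ Nm) _.
  have : r m <= limn r by exact: nondecreasing_cvgn_le.
  by move: rN nN; set a := N.+1%:R^-1; lra.
have p_cvg : p @ \oo --> lim (p @ \oo) by exact: cauchy_cvg.
exists (lim (p @ \oo)) => n.
apply: (@closed_cvg _ _ \oo _ p (C n) (Ccl n) _ _ p_cvg).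
by exists n => // m /= /Cle; apply; case: (hp m).
Unshelve. all: by end_near.
Qed.

Lemma closed_half_space w (a : R) : closed [set u | a <= dot u w].
Proof.
apply: (@closed_comp _ _ (dot^~ w) [set t | a <= t]); last exact: closed_ge.
by move=> u _; exact: dot_continuous.
Qed.

Lemma midconvex_half_space w (a : R) : midconvex [set u | a <= dot u w].
Proof. by move=> u v /= au av; rewrite !dotE; lra. Qed.

(* Stands in for weak cluster points. *)
Definition convex_limit (x : nat -> H) (w : H) :=
  forall C, closed C -> midconvex C -> (\forall n \near \oo, C (x n)) -> C w.

(** Intersects [D] with the closed convex hulls of the tails of [x]. These sets decrease, and each
    contains an iterate because [D] is visited infinitely often. *)
Lemma convex_limit_exists (x : nat -> H) (M : R) (D : set H) :
  closed D -> midconvex D -> (forall n, `|x n| <= M) ->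
  (forall N, exists2 n, (N <= n)%N & D (x n)) ->
  exists2 w, D w & convex_limit x w.
Proof.
move=> Dcl Dmid xM xD.
pose T n := [set C : set H | [/\ closed C, midconvex C &
  forall k, (n <= k)%N -> C (x k)]].
have [||||w hw] := @nested_closed_midconvex
    (fun n => D `&` \bigcap_(C in T n) C) M.
- by move=> n; apply: closedI => //; apply: closed_bigI => C [].
- move=> n u v [Du Cu] [Dv Cv]; split; first exact: Dmid.
  by move=> C TC; have [_ Cmid _] := TC; apply: Cmid; [exact: Cu|exact: Cv].
- move=> n u [Du Cu]; split=> // C [Ccl Cmid Cx]; apply: Cu; split=> // k nk.
  by apply: Cx; exact: ltnW.
- move=> n; have [k nk Dk] := xD n; exists (x k) => //; split=> // C [_ _].
  exact.
exists w; first by case: (hw 0%N).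
by move=> C Ccl Cmid [N _ CN]; have [_] := hw N; apply; split.
Qed.

(** The closed half-spaces [a - e <= dot u z] eventually contain the sequence; taking [z] to be [y]
    and [- y] gives the two inequalities. *)
Lemma dot_convex_limit (x : nat -> H) (w y : H) (l : R) :
  convex_limit x w -> dot (x n) y @[n --> \oo] --> l -> dot w y = l.
Proof.
move=> xw.
have ge z a : dot (x n) z @[n --> \oo] --> a -> a <= dot w z.
  move=> xa; apply/ler_addgt0Pl => e e0; rewrite -lerBlDl.
  apply: (xw _ (closed_half_space (w := z) (a := a - e))
    (@midconvex_half_space z _)).
  move/cvgrPdist_le : xa => /(_ _ e0); apply: filterS => n /=.
  by rewrite ler_norml => /andP[]; lra.
move=> xl; apply/eqP; rewrite eq_le ge// andbT.
rewrite -lerN2 -dotNr; apply: ge.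
by under eq_fun do rewrite dotNr; exact: cvgN.
Qed.

(** If [dot (x n) y] exceeded [dot xbar y + e] infinitely often, there would be a second convex
    limit [w] in that half-space. Both distances converge, hence so does [dot (x n) (w - xbar)]; its
    limit is its value at [w] and at [xbar], which forces [w = xbar]. *)
Lemma opial (x : nat -> H) (S : set H) :
  S !=set0 -> (forall z, S z -> cvgn (fun n => `|x n - z| ^+ 2)) ->
  (forall w, convex_limit x w -> S w) ->
  exists2 xbar, S xbar & weakly_converges dot x xbar.
Proof.
move=> [z0 Sz0] xS limS.
have [M xM] : exists M, forall n, `|x n| <= M.
  have /pinfty_ex_gt0[M M0 hM] := cvg_seq_bounded (xS _ Sz0).
  exists (1 + M + `|z0|) => n; have /= := hM n I.
  rewrite ger0_norm ?sqr_ge0// => hn.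
  have := sqr_ge0 (`|x n - z0| - 1).
  by have := ler_normD (x n - z0) z0; rewrite subrK; lra.
have [||||xbar _ xbarP] := @convex_limit_exists x M setT.
- exact: closedT.
- by [].
- exact: xM.
- by move=> N; exists N.
exists xbar; first exact: limS.
have key y e : 0 < e -> \forall n \near \oo, dot (x n) y < dot xbar y + e.
  move=> e0; apply: contrapT => hn.
  have [||||w Dw wP] := @convex_limit_exists x M
    [set u | dot xbar y + e <= dot u y].
  - exact: closed_half_space.
  - exact: midconvex_half_space.
  - exact: xM.
  - move=> N; apply: contrapT => hN; apply: hn; exists N => // n /= Nn.
    by rewrite ltNge; apply/negP => hle; apply: hN; exists n.
  have cw := xS _ (limS _ wP); have cb := xS _ (limS _ xbarP).
  have [l hl] : exists l : R, dot (x n) (w - xbar) @[n --> \oo] --> l.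
    exists (2^-1 * (`|w| ^+ 2 - `|xbar| ^+ 2
      - (limn (fun n => `|x n - w| ^+ 2) - limn (fun n => `|x n - xbar| ^+ 2)))).
    have -> : (fun n => dot (x n) (w - xbar)) = (fun n => 2^-1 *
        (`|w| ^+ 2 - `|xbar| ^+ 2 - (`|x n - w| ^+ 2 - `|x n - xbar| ^+ 2))).
      by apply/funext => n; rewrite !hdot !dotE (dotC w) (dotC xbar); field.
    by apply: cvgMl_tmp; apply: cvgB; [exact: cvg_cst|exact: (cvgB cw cb)].
  have ew := dot_convex_limit wP hl; have eb := dot_convex_limit xbarP hl.
  have : `|w - xbar| ^+ 2 = 0 by rewrite hdot dotDl dotNl ew eb subrr.
  move/eqP; rewrite expf_eq0/= normr_eq0 subr_eq0 => /eqP wb.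
  by move: Dw; rewrite wb /=; lra.
move=> y; apply/cvgrPdist_lt => e e0; near=> n.
rewrite ltr_norml; apply/andP; split.
  have : dot (x n) y < dot xbar y + e by near: n; exact: key.
  by lra.
have : dot (x n) (- y) < dot xbar (- y) + e by near: n; exact: key.
by rewrite !dotNr; lra.
Unshelve. all: by end_near.
Qed.

End Hilbert.

(** * Proximal points *)

Section Prox.
Context (R : realType) (H : completeNormedModType R).
Context (dot : {dot H for (@idfun R)}) (hdot : induces_norm dot).
Context (f : H -> \bar R) (fproper : proper_fun f) (fconvex : convex_efun f).
Context (flsc : lower_semicontinuous f).
Implicit Types u v w x y z : H.

(** The complement is open: some [r] lies strictly between [c - a |y - x|^2] and [f y], and near [y]
    it stays below [f] by lower semicontinuity and above the quadratic expression by continuity. *)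
Lemma closed_sublevel (a c : R) x :
  closed [set y | (f y + (a * `|y - x| ^+ 2)%:E <= c%:E)%E].
Proof.
rewrite -openC openE => y /= /negP; rewrite -ltNge => cy.
have [r cr ry] : exists2 r, c - a * `|y - x| ^+ 2 < r & (r%:E < f y)%E.
  case fy: (f y) (fproper.1 y) cy => [b| |] // _.
    rewrite -EFinD lte_fin => h.
    exists (2^-1 * (c - a * `|y - x| ^+ 2 + b)); last rewrite lte_fin.
      by lra.
    by lra.
  by exists (c - a * `|y - x| ^+ 2 + 1); [lra|rewrite ltry].
have [V yV Vr] := flsc ry.
have qc : (c - a * `|v - x| ^+ 2) @[v --> y] --> c - a * `|y - x| ^+ 2.
  apply: cvgB; first exact: cvg_cst.
  apply: cvgMl_tmp; apply: cvgM; apply: cvg_norm;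
    by apply: cvgB; [exact: cvg_id|exact: cvg_cst].
have : \forall v \near y, c - a * `|v - x| ^+ 2 < r.
  exact: (cvgr_lt (c - a * `|y - x| ^+ 2) qc).
move: yV; apply: filterS2 => v /Vr rv cv; apply/negP; rewrite -ltNge.
rewrite -lteBlDr// -EFinB; apply: lt_trans rv; rewrite lte_fin; exact: cv.
Qed.

Lemma midconvex_sublevel (a c : R) x : 0 <= a ->
  midconvex [set y | (f y + (a * `|y - x| ^+ 2)%:E <= c%:E)%E].
Proof.
move=> a0 u v /=.
have /(fconvex u v) : 0 <= (2^-1 : R) <= 1 by lra.
have -> : 1 - 2^-1 = 2^-1 :> R by field.
rewrite -scalerDr.
case: (f u) (fproper.1 u) => [r| |] // _.
case: (f v) (fproper.1 v) => [t| |] // _.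
rewrite -!EFinD !lee_fin => fuv qu qv.
have qm : `|2^-1 *: (u + v) - x| ^+ 2 <=
    2^-1 * (`|u - x| ^+ 2 + `|v - x| ^+ 2).
  have := parallelogram hdot (u - x) (v - x).
  have -> : u - x + (v - x) = 2 *: (2^-1 *: (u + v) - x).
    rewrite scalerBr scalerA divff// scale1r scaler_nat mulr2n.
    by rewrite opprD addrACA.
  rewrite normrZ exprMn ger0_norm//.
  by have := sqr_ge0 `|u - x - (v - x)|; lra.
apply: le_trans (leeD2r _ fuv) _.
rewrite -!EFinD lee_fin.
by have := ler_wpM2l a0 qm; lra.
Qed.

Lemma argmin_fin z : argmin f z -> f z \is a fin_num.
Proof.
move=> zmin; have [y fy] := fproper.2.
have := fproper.1 z; have := zmin y.
by move: fy; case: (f y) => //; case: (f z).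
Qed.

(** The sublevel sets of [G] at [m + 1/(n+1)] are closed, convex, decreasing and nonempty, so they
    share a point, which attains the infimum. *)
Lemma proxP (s : R) x : 0 < s -> argmin f !=set0 ->
  argmin (fun y => (f y + ((2 * s)^-1 * `|y - x| ^+ 2)%R%:E)%E) (prox s f x).
Proof.
move=> s0 [z zmin]; apply: xgetPex.
set a := (2 * s)^-1; have a0 : 0 < a by rewrite invr_gt0 mulr_gt0.
set G := fun y => _.
have fz : f z = (fine (f z))%:E by rewrite fineK// argmin_fin.
(* Only finite values of [G] are collected, so that the infimum is real. *)
pose V := [set r | exists y, G y = r%:E]; pose m := inf V.
have Glb y : ((fine (f z) + a * `|y - x| ^+ 2)%:E <= G y)%E.
  by rewrite EFinD -fz /G; apply: leeD2r; exact: zmin.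
have Vlb : lbound V (fine (f z)).
  move=> r [y yr]; have := Glb y; rewrite yr lee_fin.
  by apply: le_trans; rewrite lerDl mulr_ge0 ?sqr_ge0 ?ltW.
have Vinf : has_inf V.
  split; last by exists (fine (f z)).
  by exists (fine (f z) + a * `|z - x| ^+ 2); exists z; rewrite /G fz.
have [|||n|w wP] := @nested_closed_midconvex R H dot hdot
    (fun n => [set y | (G y <= (m + n.+1%:R^-1)%:E)%E])
    (* From [t <= 1 + t^2] with [t = |y - x|], where [f y >= f z] gives [a t^2 <= m + 1 - f z]. *)
    (`|x| + 1 + a^-1 * (m + 1 - fine (f z))).
- by move=> n; exact: closed_sublevel.
- by move=> n; apply: midconvex_sublevel; exact: ltW.
- move=> n y /= /le_trans; apply; rewrite lee_fin lerD2l.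
  by rewrite lef_pV2 ?posrE// ler_nat.
- have n0 : 0 < n.+1%:R^-1 :> R by rewrite invr_gt0.
  have n1 : n.+1%:R^-1 <= 1 :> R by rewrite invf_le1// ler1n.
  have [r [y yr] rm] := inf_adherent n0 Vinf.
  exists y; first by rewrite /= yr lee_fin ltW.
  have : a * `|y - x| ^+ 2 <= m + 1 - fine (f z).
    have := Glb y; rewrite yr lee_fin; move: rm n1; rewrite -/m.
    by set i := n.+1%:R^-1; lra.
  rewrite -ler_pdivlMl// => h.
  have := ler_normD (y - x) x; rewrite subrK.
  by have := sqr_ge0 (`|y - x| - 1); have := sqr_ge0 `|y - x|; lra.
have wm : (G w <= m%:E)%E.
  apply/lee_addgt0Pr => e e0; rewrite -EFinD.
  have [n _ hn] := near_infty_natSinv_lt (PosNum e0).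
  apply: (le_trans (wP n)); rewrite lee_fin lerD2l ltW//.
  exact: (hn n (leqnn n)).
exists w => y; apply: le_trans wm _.
have := fproper.1 y; case yr: (f y) => [r| |] // _; last by rewrite /G yr leey.
rewrite /G yr -EFinD lee_fin.
apply: ge_inf; first by exists (fine (f z)).
by exists y; rewrite /G yr.
Qed.

Lemma prox_fin (s : R) x : 0 < s -> argmin f !=set0 ->
  f (prox s f x) \is a fin_num.
Proof.
move=> s0 fz; have [z zmin] := fz; have /(_ z) := proxP x s0 fz.
have := fproper.1 (prox s f x); have := argmin_fin zmin.
by case: (f z) => // r _; case: (f _).
Qed.

Lemma prox_le (s : R) x y : 0 < s -> argmin f !=set0 -> f y \is a fin_num ->
  dot (x - prox s f x) (y - prox s f x) <=
    s * (fine (f y) - fine (f (prox s f x))).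
Proof.
move=> s0 fz fy; have min := proxP x s0 fz.
have := prox_fin x s0 fz; move: min; set p := prox s f x => min fp.
set A := fine (f y) - fine (f p) - s^-1 * dot (x - p) (y - p).
set B := (2 * s)^-1 * `|y - p| ^+ 2.
have B0 : 0 <= B by rewrite mulr_ge0// invr_ge0 mulr_ge0// ltW.
have h t : 0 < t <= 1 -> 0 <= A + t * B.
  move=> /andP[t0 t1].
  have t01 : 0 <= t <= 1 by rewrite ltW.
  have := le_trans (min _) (leeD2r _ (fconvex y p t01)).
  rewrite -(fineK fy) -(fineK fp) -?EFinM -?EFinD lee_fin.
  rewrite -(pmulr_rge0 _ t0) /A /B !hdot !dotE invfM.
  by rewrite (dotC dot p x) (dotC dot y x) (dotC dot y p); lra.
have A0 : 0 <= A.
  rewrite leNgt; apply/negP => A0.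
  have BA : 0 < B - A by lra.
  (* If [A < 0], this [t] lies in []0, 1]] and makes [A + t * B] equal to [- A^2 / (B - A) < 0]. *)
  have := h (- A / (B - A)); rewrite divr_gt0 ?oppr_gt0// ler_pdivrMr// mul1r.
  have -> : - A <= B - A by lra.
  move=> /(_ isT); apply/negP; rewrite -ltNge.
  have -> : A + - A / (B - A) * B = - (A ^+ 2 / (B - A)) by field; lra.
  by rewrite oppr_lt0 divr_gt0// exprn_even_gt0//= lt_eqF.
by move: A0; rewrite /A subr_ge0 ler_pdivrMl.
Qed.

Lemma argmin_convex_limit (x : nat -> H) z w : argmin f z ->
  (forall e, 0 < e -> \forall n \near \oo, (f (x n) <= f z + e%:E)%E) ->
  convex_limit x w -> argmin f w.
Proof.
move=> zmin fx xw y; apply: le_trans (zmin y).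
apply/lee_addgt0Pr => e e0.
have fz := argmin_fin zmin.
have := xw _ (@closed_sublevel 0 (fine (f z) + e) 0)
  (@midconvex_sublevel 0 (fine (f z) + e) 0 (lexx _)).
rewrite /= mul0r adde0 EFinD fineK//; apply.
by under eq_near do rewrite mul0r adde0; exact: fx.
Qed.

End Prox.

(** * Summable perturbations *)

Lemma near_succ (P : nat -> Prop) :
  (\forall k \near \oo, P k) -> \forall k \near \oo, P k.+1.
Proof. by move=> [N _ hN]; exists N => // k /= Nk; apply: hN; exact: leqW. Qed.

Section NearSummable.
Context (R : realType).
Implicit Types (a D W eta h u : nat -> R).

(* For nonnegative [D] this amounts to the convergence of the series of [D],
   [W k] playing the role of its remainder. *)
Definition near_summable D :=
  exists W : nat -> R, \forall k \near \oo, 0 <= W k /\ D k <= W k - W k.+1.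

Lemma near_summable_le D D' : (\forall k \near \oo, D k <= D' k) ->
  near_summable D' -> near_summable D.
Proof.
move=> DD' [W hW]; exists W; apply: filterS2 DD' hW => k DD' [W0 D'W].
by split=> //; exact: le_trans D'W.
Qed.

Lemma near_summableD D D' : near_summable D -> near_summable D' ->
  near_summable (D \+ D').
Proof.
move=> [W hW] [W' hW']; exists (W \+ W'); apply: filterS2 hW hW' => k /=.
by move=> [? ?] [? ?]; split; lra.
Qed.

Lemma near_summableZ (c : R) D : 0 <= c -> near_summable D ->
  near_summable (fun k => c * D k).
Proof.
move=> c0 [W hW]; exists (fun k => c * W k); apply: filterS hW => k [W0 DW].
by split; [exact: mulr_ge0|rewrite -mulrBr; exact: ler_wpM2l].
Qed.

Lemma near_summableS D : near_summable D -> near_summable (fun k => D k.+1).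
Proof. by move=> [W hW]; exists (fun k => W k.+1); exact: near_succ hW. Qed.

Lemma near_nonincreasing_ge0_cvg u :
  (\forall k \near \oo, 0 <= u k /\ u k.+1 <= u k) -> cvgn u.
Proof.
move=> [N _ hN]; suff c : cvgn (fun n => u (n + N)%N).
  apply/cvg_ex; exists (limn (fun n => u (n + N)%N)).
  by rewrite -(cvg_shiftn N).
apply: nonincreasing_is_cvgn.
  apply/nonincreasing_seqP => n /=; rewrite addSn.
  by case: (hN _ (leq_addl n N)).
by exists 0 => _ [n _ <-]; case: (hN _ (leq_addl n N)).
Qed.

Lemma near_summable_cvg0 D : (\forall k \near \oo, 0 <= D k) ->
  near_summable D -> D @ \oo --> (0 : R).
Proof.
move=> D0 [W hW]; have Wc : cvgn W.
  apply: near_nonincreasing_ge0_cvg.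
  by apply: filterS2 D0 hW => k ? [? ?]; split=> //; lra.
apply: (@squeeze_cvgr _ _ _ _ (cst 0) (fun k => W k - W k.+1)).
- by apply: filterS2 D0 hW => k ? [? ?]; apply/andP.
- exact: cvg_cst.
- rewrite -(subrr (limn W)); apply: cvgB => //.
  by rewrite (cvg_shiftS W).
Qed.

(** With [W] the remainder of [D], both [W] and [h \+ W] are eventually nonincreasing and
    nonnegative. *)
Lemma near_summable_cvg D h : (\forall k \near \oo, 0 <= D k) ->
  near_summable D -> (\forall k \near \oo, 0 <= h k) ->
  (\forall k \near \oo, h k.+1 <= h k + D k) -> cvgn h.
Proof.
move=> D0 [W hW] h0 hD.
have Wc : cvgn W.
  apply: near_nonincreasing_ge0_cvg.
  by apply: filterS2 D0 hW => k ? [? ?]; split=> //; lra.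
have hWc : cvgn (h \+ W).
  apply: near_nonincreasing_ge0_cvg; near=> k => /=.
  have [h0k hDk [W0 DW]] : [/\ 0 <= h k, h k.+1 <= h k + D k &
      0 <= W k /\ D k <= W k - W k.+1] by split; near: k.
  by split; lra.
have -> : h = (h \+ W) \- W by apply/funext => k /=; rewrite addrK.
exact: is_cvgB.
Unshelve. all: by end_near.
Qed.

(** Deterministic Robbins-Siegmund lemma whose relative error also bears on the new term [a k.+1];
    it rests on a discrete Gronwall argument. *)
Lemma robbins_siegmund a D eta : near_summable eta ->
  (\forall k \near \oo, [/\ 0 <= a k, 0 <= D k, 0 <= eta k &
    (1 - eta k) * a k.+1 + D k <= (1 + eta k) * a k + eta k]) ->
  (exists M, \forall k \near \oo, a k <= M) /\ near_summable D.
Proof.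
move=> eta_sum hk.
have eta_half : \forall k \near \oo, eta k < 2^-1.
  apply: (@cvgr_lt _ _ _ _ _ 0); last by rewrite invr_gt0.
  by apply: near_summable_cvg0 => //; apply: filterS hk => k [].
have [T hT] := eta_sum.
have step : \forall k \near \oo,
    [/\ 0 <= a k, 0 <= D k, 0 <= T k, 0 <= eta k <= T k - T k.+1 &
        a k.+1 + D k <= (1 + 4 * eta k) * a k + 2 * eta k].
  have hk' := near_succ hk; near=> k.
  have [a0 D0 e0 ineq] : [/\ 0 <= a k, 0 <= D k, 0 <= eta k &
    (1 - eta k) * a k.+1 + D k <= (1 + eta k) * a k + eta k] by near: k.
  have [a0' _ _ _] : [/\ 0 <= a k.+1, 0 <= D k.+1, 0 <= eta k.+1 &
    (1 - eta k.+1) * a k.+2 + D k.+1 <= (1 + eta k.+1) * a k.+1 + eta k.+1].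
    by near: k.
  have e2 : eta k < 2^-1 by near: k.
  have [T0 eT] : 0 <= T k /\ eta k <= T k - T k.+1 by near: k.
  split=> //; first by rewrite e0.
  (* Multiplying by [1 + 2 * eta k] brings the coefficient of [a k.+1] above 1, as
     [(1 + 2e)(1 - e) = 1 + e(1 - 2e)]. *)
  have e1 : 0 <= 1 + 2 * eta k by lra.
  have e3 : 0 <= 1 - 2 * eta k by lra.
  have := ler_wpM2l e1 ineq.
  have := mulr_ge0 (mulr_ge0 e0 e3) a0'; have := mulr_ge0 (mulr_ge0 e0 e3) a0.
  by have := mulr_ge0 e0 D0; have := mulr_ge0 e0 e3; lra.
have [N _ hN] := step.
(* Nonincreasing: [a k + 1] grows at most by the factor [1 + 4 * eta k <= expR (4 * (T k - T
   k.+1))]. *)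
pose B k := (a k + 1) * expR (4 * T k).
have B_le k : (N <= k)%N -> B k <= B N.
  move=> Nk; rewrite -(subnK Nk); elim: (k - N)%N => [//|j ih].
  apply: le_trans ih; rewrite addSn; set i := (j + N)%N.
  have [a0 D0 T0 /andP[e0 eT] ineq] := hN i (leq_addl _ _).
  have a1 : 0 <= a i + 1 by rewrite addr_ge0.
  rewrite /B -(ler_pM2r (expR_gt0 (- (4 * T i.+1)))) -!mulrA -!expRD.
  rewrite subrr expR0 mulr1.
  apply: (@le_trans _ _ ((a i + 1) * (1 + 4 * eta i))); first by lra.
  apply: ler_wpM2l => //; apply: le_trans (expR_ge1Dx _) _.
  by rewrite ler_expR; lra.
have aM k : (N <= k)%N -> a k <= B N.
  move=> Nk; apply: le_trans (B_le _ Nk); have [a0 _ T0 _ _] := hN _ Nk.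
  apply: (@le_trans _ _ (a k + 1)); first by rewrite lerDl.
  by rewrite ler_peMr ?addr_ge0// -expR0 ler_expR mulr_ge0.
split; first by exists (B N); exists N.
have B0 : 0 <= B N.
  by have [a0 _ _ _ _] := hN N (leqnn N); rewrite mulr_ge0 ?addr_ge0 ?expR_ge0.
exists (fun k => a k + (4 * B N + 2) * T k); exists N => // k Nk.
have [a0 D0 T0 /andP[e0 eT] ineq] := hN k Nk.
have := ler_wpM2l e0 (aM k Nk); have c0 : 0 <= 4 * B N + 2 by lra.
have := ler_wpM2l c0 eT; have := mulr_ge0 c0 T0.
by split; lra.
Unshelve. all: by end_near.
Qed.

(** The remainder is the integral of [t^(-r)] from [k - 1] to infinity; starting at [k = 2] keeps
    [k - 1] positive. *)
Lemma near_summable_powRN (r : R) : 1 < r ->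
  near_summable (fun k => k%:R `^ (- r)).
Proof.
move=> r1; have nu0 : 0 < r - 1 by rewrite subr_gt0.
exists (fun k => (r - 1)^-1 * k.-1%:R `^ (- (r - 1))).
exists 2%N => // -[//|[//|k]] _; split.
  by rewrite mulr_ge0 ?powR_ge0// invr_ge0 ltW.
rewrite -mulrBr ler_pdivlMl// /=.
have k0 : 0 < k.+1%:R :> R by []; have k1 : 0 < k.+2%:R :> R by [].
have -> : - r = - (r - 1) - 1 by ring.
rewrite powRB ?(gt_eqF k1) ?implybT// powRr1//.
have -> : k.+1%:R `^ (- (r - 1)) =
    k.+2%:R `^ (- (r - 1)) * expR (- ((r - 1) * ln (1 - k.+2%:R^-1 : R))).
  have -> : 1 - k.+2%:R^-1 = k.+1%:R / k.+2%:R :> R.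
    apply: (mulIf (lt0r_neq0 k1)); rewrite divfK ?gt_eqF// mulrBl mul1r.
    by rewrite mulVf ?gt_eqF// -natr1 addrK.
  by rewrite /powR !gt_eqF// -expRD ln_div//; congr expR; ring.
rewrite mulrCA -[X in _ <= _ - X]mulr1 -mulrBr ler_wpM2l ?powR_ge0//.
have l1 : ln (1 - k.+2%:R^-1 : R) <= - k.+2%:R^-1.
  by apply: le_ln1Dx; rewrite ltrN2 invf_lt1// ltr1n.
have := expR_ge1Dx (- ((r - 1) * ln (1 - k.+2%:R^-1 : R))).
have := ler_wpM2l (ltW nu0) l1.
by set i := k.+2%:R^-1; set l := ln _; lra.
Qed.

End NearSummable.

(** * The energy estimate *)

Section Inertial.
Context (R : realType) (H : completeNormedModType R).
Context (dot : {dot H for (@idfun R)}) (hdot : induces_norm dot).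
Context (f : H -> \bar R) (fproper : proper_fun f) (fconvex : convex_efun f).
Context (flsc : lower_semicontinuous f).
(** Abstract form of the scheme: [s k], [c k], [lam k] will be [k^q], [c / k^p], [lambda k^delta],
    and [l] will be [lambda]. *)
Context (alpha b m l : R) (s c lam : nat -> R) (x : nat -> H).
Context (b_gt0 : 0 < b) (m_gt0 : 0 < m) (l_gt0 : 0 < l).
Context (s_unbounded : forall A, \forall k \near \oo, A <= s k).
Context (s_concave : \forall k \near \oo,
  0 <= s k.+2 - s k.+1 <= s k.+1 - s k).
Context (s_slow : \forall k \near \oo, s k.+1 - s k <= alpha - b - m).
Context (lam_ge : \forall k \near \oo, l <= lam k).
(** Growth of the weight of [gap] in [energy] must not exceed what the proximal inequality at [z],
    multiplied by [b * s k], supplies. *)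
Context (weight_slow : \forall k \near \oo,
  s k.+1 * (s k.+2 - alpha) * lam k.+1 - s k * (s k.+1 - alpha) * lam k
    <= b * (s k * lam k)).
Context (c_ge0 : \forall k \near \oo, 0 <= c k).
Context (c_sum : near_summable (fun k => s k * c k)).
Context (hx : \forall k \near \oo, x k.+1 = prox (lam k) f
  (x k + (1 - alpha / s k) *: (x k - x k.-1) - c k *: x k)).

Lemma alpha_gt0 : 0 < alpha.
Proof.
suff [k /andP[]] : exists k, 0 <= s k.+1 - s k <= alpha - b - m.
  by move: b_gt0 m_gt0; lra.
have [N _ hN] : \forall k \near \oo, 0 <= s k.+1 - s k <= alpha - b - m.
  near=> k; apply/andP; split; last by near: k.
  have : 0 <= s k.+2 - s k.+1 <= s k.+1 - s k by near: k.
  by case/andP; apply: le_trans.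
by exists N; exact: hN _ (leqnn N).
Unshelve. all: by end_near.
Qed.

(** * Estimates relative to a fixed minimizer *)

Section FixedMinimizer.
Context (z : H) (zmin : argmin f z).

Let gap u := fine (f u) - fine (f z).

(** The argument of the proximal map minus [x k.+1], that is, [lam k] times a subgradient of [f] at
    [x k.+1]. *)
Let residual k :=
  (1 - alpha / s k) *: (x k - x k.-1) - c k *: x k - (x k.+1 - x k).

Lemma gap_ge0 u : f u \is a fin_num -> 0 <= gap u.
Proof.
by move=> fu; rewrite subr_ge0 -lee_fin !fineK//; exact: argmin_fin.
Qed.

Lemma iterate_fin : \forall k \near \oo, f (x k) \is a fin_num.
Proof.
apply: near_inftyS; near=> k; have lk : l <= lam k by near: k.
suff -> : x k.+1 = prox (lam k) f
    (x k + (1 - alpha / s k) *: (x k - x k.-1) - c k *: x k).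
  by apply: (prox_fin hdot) => //; [exact: lt_le_trans lk|exists z].
by near: k.
Unshelve. all: by end_near.
Qed.

Lemma residual_le : \forall k \near \oo,
  [/\ 0 <= gap (x k), 0 <= gap (x k.+1),
      lam k * gap (x k.+1) <= dot (residual k) (x k.+1 - z) &
      lam k * (gap (x k.+1) - gap (x k)) <=
        dot (residual k) (x k.+1 - x k)].
Proof.
have fz : argmin f !=set0 by exists z.
have finS := near_succ iterate_fin; near=> k.
have lk : l <= lam k by near: k.
have l0 := lt_le_trans l_gt0 lk.
have f0 : f (x k) \is a fin_num by near: k; exact: iterate_fin.
have f1 : f (x k.+1) \is a fin_num by near: k.
have xk : x k.+1 = prox (lam k) f
    (x k + (1 - alpha / s k) *: (x k - x k.-1) - c k *: x k) by near: k.
have res : residual k =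
    x k + (1 - alpha / s k) *: (x k - x k.-1) - c k *: x k - x k.+1.
  by rewrite /residual opprB addrA; congr (_ - _); rewrite (addrC _ (x k)) addrA.
split; [exact: gap_ge0|exact: gap_ge0|..].
- have := prox_le hdot fproper fconvex flsc
    (x k + (1 - alpha / s k) *: (x k - x k.-1) - c k *: x k) l0 fz
    (argmin_fin fproper zmin).
  by rewrite -xk -res -(opprB (x k.+1)) dotNr /gap; lra.
- have := prox_le hdot fproper fconvex flsc
    (x k + (1 - alpha / s k) *: (x k - x k.-1) - c k *: x k) l0 fz f0.
  by rewrite -xk -res -(opprB (x k.+1)) dotNr /gap; lra.
Unshelve. all: by end_near.
Qed.

(* Since [s k - alpha] is [alpha_k s_k], the increments of [momentum] only
   involve the next velocity, the residual and the term [c k *: x k]. *)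
Let momentum k := b *: (x k - z) + (s k - alpha) *: (x k - x k.-1).

Let energy k := 2 * (s k * (s k.+1 - alpha) * lam k) * gap (x k)
  + `|momentum k| ^+ 2 + b * (alpha - b - (s k.+1 - s k)) * `|x k - z| ^+ 2.

(** The momentum increases by [- d *: V - S *: (g + e)]. The square of this increment is dropped,
    and [2 * dot X V] is written as [|X|^2 - |X - V|^2 + |V|^2]. *)
Lemma momentum_step (X V g e : H) (B S t d : R) : B + t - S = - d ->
  `|B *: X + t *: V| ^+ 2 <= `|B *: (X - V) + S *: (g + V + e)| ^+ 2
    - d * B * (`|X| ^+ 2 - `|X - V| ^+ 2 + `|V| ^+ 2) - 2 * d * t * `|V| ^+ 2
    - 2 * S * B * dot g X - 2 * S * t * dot g V
    - 2 * S * dot e (B *: X + t *: V).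
Proof.
move=> dE; have {dE} -> : d = S - B - t by lra.
have := sqr_ge0 `|(B *: X + t *: V) - (B *: (X - V) + S *: (g + V + e))|.
rewrite !hdot !dotE (dotC dot V X) (dotC dot X g) (dotC dot V g) (dotC dot X e).
rewrite (dotC dot V e) (dotC dot e g).
lra.
Qed.

(* Relative error in one step of the energy estimate: the perturbation
   [c k *: x k], and the variation of the coefficient of [`|x k - z| ^+ 2]. *)
Let drag k := (2 + (b * m)^-1 + `|z| ^+ 2) * (s k * c k)
  + m^-1 * ((s k.+1 - s k) - (s k.+2 - s k.+1)).

Lemma drag_sum : near_summable drag.
Proof.
apply: near_summableD; apply: near_summableZ => //; last 2 first.
- by rewrite invr_ge0 ltW.
- exists (fun k => s k.+1 - s k); near=> k; split=> //.
  have : 0 <= s k.+2 - s k.+1 <= s k.+1 - s k by near: k.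
  by case/andP; apply: le_trans.
- by rewrite !addr_ge0 ?sqr_ge0// invr_ge0 mulr_ge0 ?ltW.
Unshelve. all: by end_near.
Qed.

(** For large [k] the weight of [gap] is at least [2 * l * s k], and by [s_slow] that of
    [|x k - z|^2] is at least [b * m]. *)
Lemma energy_ge : \forall k \near \oo,
  [/\ 0 <= energy k, `|momentum k| ^+ 2 <= energy k,
      b * m * `|x k - z| ^+ 2 <= energy k &
      l * s k * gap (x k) <= energy k].
Proof.
near=> k.
have s0 : 1 <= s k by near: k; exact: s_unbounded.
have s2a : 2 * alpha <= s k by near: k; exact: s_unbounded.
have s1a : alpha + 1 <= s k.+1 by near: k; exact: near_succ (s_unbounded _).
have [F0 _ _ _] : [/\ 0 <= gap (x k), 0 <= gap (x k.+1),
      lam k * gap (x k.+1) <= dot (residual k) (x k.+1 - z) &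
      lam k * (gap (x k.+1) - gap (x k)) <=
        dot (residual k) (x k.+1 - x k)] by near: k; exact: residual_le.
have ll : l <= lam k by near: k.
have rho : s k.+1 - s k <= alpha - b - m by near: k.
have U0 := sqr_ge0 `|momentum k|; have h0 := sqr_ge0 `|x k - z|.
have t0 : 0 <= s k.+1 - alpha - 1 by lra.
have dh : b * m * `|x k - z| ^+ 2 <=
    b * (alpha - b - (s k.+1 - s k)) * `|x k - z| ^+ 2.
  by apply: ler_wpM2r => //; apply: ler_wpM2l; [exact: ltW|lra].
have bmh : 0 <= b * m * `|x k - z| ^+ 2 by rewrite mulr_ge0// mulr_ge0 ?ltW.
have sF : 0 <= s k * gap (x k) by rewrite mulr_ge0//; lra.
have wF : l * s k * gap (x k) <= s k * (s k.+1 - alpha) * lam k * gap (x k).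
  have lF : l * (s k * gap (x k)) <= lam k * (s k * gap (x k)).
    exact: ler_wpM2r.
  have : 0 <= (s k.+1 - alpha - 1) * (lam k * (s k * gap (x k))).
    by rewrite mulr_ge0// mulr_ge0// (le_trans _ ll)// ltW.
  by lra.
have lsF : 0 <= l * s k * gap (x k) by rewrite -mulrA mulr_ge0// ltW.
rewrite /energy; split; lra.
Unshelve. all: by end_near.
Qed.

(** Adds to [momentum_step] the inequalities of [residual_le], at [z] with weight [s k * b] and at
    [x k] with weight [s k * (s k.+1 - alpha)]. What remains is bounded by
    [drag k * (1 + energy k + energy k.+1)]. *)
Lemma energy_decrease : \forall k \near \oo,
  [/\ 0 <= energy k, 0 <= m * (s k * `|x k.+1 - x k| ^+ 2), 0 <= drag k &
    (1 - drag k) * energy k.+1 + m * (s k * `|x k.+1 - x k| ^+ 2) <=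
      (1 + drag k) * energy k + drag k].
Proof.
have energy_geS := near_succ energy_ge; near=> k.
have s0 : 1 <= s k by near: k; exact: s_unbounded.
have s2a : 2 * alpha <= s k by near: k; exact: s_unbounded.
have [_ F1 gX gV] : [/\ 0 <= gap (x k), 0 <= gap (x k.+1),
      lam k * gap (x k.+1) <= dot (residual k) (x k.+1 - z) &
      lam k * (gap (x k.+1) - gap (x k)) <=
        dot (residual k) (x k.+1 - x k)] by near: k; exact: residual_le.
have ll : l <= lam k by near: k.
have c0 : 0 <= c k by near: k.
have rho : s k.+1 - s k <= alpha - b - m by near: k.
have /andP[rho1 rho01] : 0 <= s k.+2 - s k.+1 <= s k.+1 - s k by near: k.
have w01 : s k.+1 * (s k.+2 - alpha) * lam k.+1 - s k * (s k.+1 - alpha) * lam k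
    <= b * (s k * lam k) by near: k.
have [E0 U0 h0 _] : [/\ 0 <= energy k, `|momentum k| ^+ 2 <= energy k,
      b * m * `|x k - z| ^+ 2 <= energy k &
      l * s k * gap (x k) <= energy k] by near: k; exact: energy_ge.
have [E1 U1 h1 _] : [/\ 0 <= energy k.+1, `|momentum k.+1| ^+ 2 <= energy k.+1,
      b * m * `|x k.+1 - z| ^+ 2 <= energy k.+1 &
      l * s k.+1 * gap (x k.+1) <= energy k.+1] by near: k.
have V0 := sqr_ge0 `|x k.+1 - x k|.
have sp : 0 < s k by lra.
have g0 : 0 <= s k * c k by rewrite mulr_ge0// ltW.
have mi : 0 < m^-1 by rewrite invr_gt0.
have bmi : 0 < (b * m)^-1 by rewrite invr_gt0 mulr_gt0.
have Z0 := sqr_ge0 `|z|.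
have d0 : 0 <= (s k.+1 - s k) - (s k.+2 - s k.+1) by lra.
have drag0 : 0 <= drag k.
  apply: addr_ge0; last by apply: mulr_ge0 => //; exact: ltW.
  by apply: mulr_ge0 => //; rewrite !addr_ge0// ltW.
split=> //; first by rewrite !mulr_ge0 ?(ltW sp) ?(ltW m_gt0).
set d := alpha - b - (s k.+1 - s k); have dm : m <= d by rewrite /d; lra.
have hd : b + (s k.+1 - alpha) - s k = - d by rewrite /d; ring.
have := momentum_step (x k.+1 - z) (x k.+1 - x k) (residual k) (c k *: x k) hd.
have -> : x k.+1 - z - (x k.+1 - x k) = x k - z by rewrite opprB addrC subrKA.
have -> : residual k + (x k.+1 - x k) + c k *: x k =
    (1 - alpha / s k) *: (x k - x k.-1) by rewrite /residual !subrK.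
(* As [s k * (1 - alpha / s k) = s k - alpha], the right-hand side contains the previous
   momentum. *)
rewrite scalerA mulrBr mulr1 mulrCA divff ?gt_eqF// mulr1.
rewrite -/(momentum k) -[_ + (s k.+1 - alpha) *: _]/(momentum k.+1).
rewrite dotZl => mom.
(* Splits [x k] as [(x k - z) + z] and applies Young's inequality to each part. *)
have pert : - (2 * s k * (c k * dot (x k) (momentum k.+1))) <=
    s k * c k * (`|x k - z| ^+ 2 + `|z| ^+ 2 + 2 * `|momentum k.+1| ^+ 2).
  have := dot_ge_norm hdot (x k - z) (momentum k.+1).
  have := dot_ge_norm hdot z (momentum k.+1); rewrite dotDl dotNl => h2 h3.
  have h4 : - (2 * dot (x k) (momentum k.+1)) <=
    `|x k - z| ^+ 2 + `|z| ^+ 2 + 2 * `|momentum k.+1| ^+ 2 by lra.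
  by have := ler_wpM2l g0 h4; lra.
have hE : `|x k - z| ^+ 2 <= (b * m)^-1 * energy k.
  by rewrite ler_pdivlMl// mulr_gt0.
have pertE : - (2 * s k * (c k * dot (x k) (momentum k.+1))) <=
    (2 + (b * m)^-1 + `|z| ^+ 2) * (s k * c k) * (1 + energy k + energy k.+1).
  have h2 : `|x k - z| ^+ 2 + `|z| ^+ 2 + 2 * `|momentum k.+1| ^+ 2 <=
      (2 + (b * m)^-1 + `|z| ^+ 2) * (1 + energy k + energy k.+1).
    move: hE U1; have := mulr_ge0 (ltW bmi) E1; have := mulr_ge0 Z0 E0.
    have := mulr_ge0 Z0 E1; set i := (b * m)^-1 in bmi *; lra.
  by have := ler_wpM2l g0 h2; lra.
(* Passing from [k] to [k.+1] raises the coefficient of the squared distance by this second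
   difference of [s]. *)
have driftE : b * ((s k.+1 - s k) - (s k.+2 - s k.+1)) * `|x k.+1 - z| ^+ 2 <=
    m^-1 * ((s k.+1 - s k) - (s k.+2 - s k.+1)) * (1 + energy k + energy k.+1).
  have h2 : b * `|x k.+1 - z| ^+ 2 <= m^-1 * (1 + energy k + energy k.+1).
    by rewrite ler_pdivlMl// mulrA (mulrC m); lra.
  by have := ler_wpM2l d0 h2; lra.
have t0 : s k <= 2 * (s k.+1 - alpha) by lra.
have gapX := ler_wpM2l (mulr_ge0 (ltW sp) (ltW b_gt0)) gX.
have gapV : s k * (s k.+1 - alpha) * (lam k * (gap (x k.+1) - gap (x k))) <=
    s k * (s k.+1 - alpha) * dot (residual k) (x k.+1 - x k).
  by apply: ler_wpM2l => //; rewrite mulr_ge0 ?(ltW sp)//; lra.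
have gapW := ler_wpM2r F1 w01.
have kin1 : 0 <= d * b * `|x k.+1 - x k| ^+ 2.
  by rewrite !mulr_ge0 ?(ltW b_gt0)//; exact: le_trans (ltW m_gt0) dm.
have kin2 : m * (s k * `|x k.+1 - x k| ^+ 2) <=
    2 * d * (s k.+1 - alpha) * `|x k.+1 - x k| ^+ 2.
  by have := ler_wpM2r V0 (ler_pM (ltW m_gt0) (ltW sp) dm t0); lra.
have total : energy k.+1 + m * (s k * `|x k.+1 - x k| ^+ 2) <=
    energy k + drag k * (1 + energy k + energy k.+1).
  have E0E : energy k = 2 * (s k * (s k.+1 - alpha) * lam k) * gap (x k) +
    `|momentum k| ^+ 2 + b * d * `|x k - z| ^+ 2 by [].
  have E1E : energy k.+1 =
    2 * (s k.+1 * (s k.+2 - alpha) * lam k.+1) * gap (x k.+1) +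
    `|momentum k.+1| ^+ 2 +
    b * (d + (s k.+1 - s k - (s k.+2 - s k.+1))) * `|x k.+1 - z| ^+ 2.
    by rewrite /energy /d; ring.
  rewrite /drag [leRHS]addrC mulrDl.
  move: mom pertE driftE gapX gapV gapW kin1 kin2.
  set N := `|x k.+1 - x k| ^+ 2.
  set P := (2 + _ + _) * _ * _; set Q := m^-1 * _ * _.
  clearbody d P Q.
  lra.
by lra.
Unshelve. all: by end_near.
Qed.

Lemma energy_bounded : exists M, \forall k \near \oo, energy k <= M.
Proof. by have [] := robbins_siegmund drag_sum energy_decrease. Qed.

Lemma velocity_sum : near_summable (fun k => s k * `|x k.+1 - x k| ^+ 2).
Proof.
have [_] := robbins_siegmund drag_sum energy_decrease.
have mi : 0 <= m^-1 by rewrite invr_ge0 ltW.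
move=> /(near_summableZ mi); apply: near_summable_le.
by near=> k; rewrite mulKf// gt_eqF.
Unshelve. all: by end_near.
Qed.

Lemma value_cvg e : 0 < e -> \forall k \near \oo, (f (x k) <= f z + e%:E)%E.
Proof.
move=> e0; have [M hM] := energy_bounded; near=> k.
have fk : f (x k) \is a fin_num by near: k; exact: iterate_fin.
have EM : energy k <= M by near: k.
have [E0 _ _ gE] : [/\ 0 <= energy k, `|momentum k| ^+ 2 <= energy k,
      b * m * `|x k - z| ^+ 2 <= energy k &
      l * s k * gap (x k) <= energy k] by near: k; exact: energy_ge.
(* The [+ 1] keeps [s k] positive even if [M] is 0. *)
have sM : M / (l * e) + 1 <= s k by near: k; exact: s_unbounded.
have le0 : 0 < l * e by rewrite mulr_gt0.
have s0 : 0 < s k.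
  apply: lt_le_trans sM; rewrite ltr_wpDl// divr_ge0 ?(ltW le0)//.
  exact: le_trans EM.
suff : gap (x k) <= e.
  rewrite /gap -(fineK fk) -(fineK (argmin_fin fproper zmin)) -EFinD lee_fin.
  by rewrite !fineK ?(argmin_fin fproper zmin)//; lra.
rewrite -(ler_pM2l (mulr_gt0 l_gt0 s0)).
apply: le_trans gE _; apply: le_trans EM _.
move: sM; rewrite -lerBrDr ler_pdivrMr// => sM.
by have := ltW le0; lra.
Unshelve. all: by end_near.
Qed.

(** It suffices that the positive parts [pos] of the increments be summable. The proximal inequality
    at [z] gives [pos k.+1 <= a * pos k] up to errors, with
    [s k.+1 * a = s k.+1 - alpha <= s k - b]. Multiplied by [s k.+1], it makes [s k * pos k]
    decrease by [b * pos k] up to a summable error. *)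
Lemma distance_cvg : cvgn (fun k => `|x k - z| ^+ 2).
Proof.
pose var k : R := `|x k.+1 - z| ^+ 2 - `|x k - z| ^+ 2.
pose pos k : R := Num.max 0 (var k).
have pos0 k : 0 <= pos k :> R by rewrite le_max lexx.
suff pos_sum : near_summable pos.
  apply: (near_summable_cvg _ pos_sum).
  - by near=> k; exact: pos0.
  - by near=> k; exact: sqr_ge0.
  - near=> k; have : var k <= pos k by rewrite le_max lexx orbT.
    by rewrite /var; lra.
have [M hM] := energy_bounded.
have bm : 0 < b * m by rewrite mulr_gt0.
have dist_le : \forall k \near \oo, `|x k - z| ^+ 2 <= M / (b * m).
  near=> k; have EM : energy k <= M by near: k.
  have [_ _ hE _] : [/\ 0 <= energy k, `|momentum k| ^+ 2 <= energy k,
      b * m * `|x k - z| ^+ 2 <= energy k &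
      l * s k * gap (x k) <= energy k] by near: k; exact: energy_ge.
  by rewrite ler_pdivlMr// mulrC; exact: le_trans EM.
set M1 := M / _ in dist_le.
have M10 : 0 <= M1.
  by have [N _ /(_ N (leqnn N))] := dist_le; apply: le_trans; exact: sqr_ge0.
(* Bounds [|x k.+1|^2 + |x k.+2 - z|^2], the first square being at most [2 * (M1 + |z|^2)]. *)
pose B := 3 * M1 + 2 * `|z| ^+ 2.
have B0 : 0 <= B by have := sqr_ge0 `|z|; rewrite /B; lra.
have decrease : \forall k \near \oo, b * pos k <=
    s k * pos k - s k.+1 * pos k.+1 +
    (4 * (s k * `|x k.+1 - x k| ^+ 2) + B * (s k.+1 * c k.+1)).
  have resS := near_succ residual_le; have cS := near_succ c_ge0.
  have lamS := near_succ lam_ge.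
  have dist_leS := near_succ dist_le; have dist_leSS := near_succ dist_leS.
  near=> k.
  have a0 := alpha_gt0.
  have s0 : alpha + 1 <= s k by near: k; exact: s_unbounded.
  have s1 : alpha + 1 <= s k.+1 by near: k; exact: near_succ (s_unbounded _).
  have c1 : 0 <= c k.+1 by near: k.
  have l1 : l <= lam k.+1 by near: k.
  have rho : s k.+1 - s k <= alpha - b - m by near: k.
  have d1 : `|x k.+1 - z| ^+ 2 <= M1 by near: k.
  have d2 : `|x k.+2 - z| ^+ 2 <= M1 by near: k.
  have [_ F2 gX _] : [/\ 0 <= gap (x k.+1), 0 <= gap (x k.+2),
      lam k.+1 * gap (x k.+2) <= dot (residual k.+1) (x k.+2 - z) &
      lam k.+1 * (gap (x k.+2) - gap (x k.+1)) <=
        dot (residual k.+1) (x k.+2 - x k.+1)] by near: k.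
  have {gX} : 0 <= dot (residual k.+1) (x k.+2 - z).
    apply: le_trans gX; rewrite mulr_ge0//; exact: le_trans (ltW l_gt0) l1.
  rewrite /residual /=; set v := x k.+1 - x k; set V := x k.+2 - x k.+1.
  set X := x k.+2 - z in d2 *; set Y := x k.+1 - z in d1 *.
  set a := 1 - alpha / s k.+1.
  have sp : 0 < s k.+1 by lra.
  have sa : s k.+1 * a = s k.+1 - alpha.
    by rewrite /a mulrBr mulr1 mulrCA divff ?gt_eqF// mulr1.
  have a1 : 0 <= a <= 1.
    rewrite /a subr_ge0 ler_pdivrMr// gerBl divr_ge0 ?(ltW sp) ?(ltW a0)//.
    by rewrite mul1r andbT; lra.
  have XE : X = Y + V by rewrite /X /Y /V [RHS]addrC subrKA.
  have xE : x k - z = Y - v by rewrite /Y /v opprB [RHS]addrC subrKA.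
  have YE : x k.+1 = Y + z by rewrite subrK.
  have var0 : var k = `|Y| ^+ 2 - `|x k - z| ^+ 2 by [].
  have var1 : var k.+1 = `|X| ^+ 2 - `|Y| ^+ 2 by [].
  clearbody v V X Y; rewrite !dotDl !dotNl !dotZl => h0.
  have hV : 2 * dot V X = `|X| ^+ 2 - `|Y| ^+ 2 + `|V| ^+ 2.
    by rewrite XE !hdot !dotE (dotC dot Y V); ring.
  have hv : 2 * dot v X <=
      `|Y| ^+ 2 - `|x k - z| ^+ 2 + 2 * `|v| ^+ 2 + `|V| ^+ 2.
    have := dot_norm_le hdot v V.
    by rewrite xE XE !hdot !dotE (dotC dot Y v); lra.
  have hx1 : - (2 * dot (x k.+1) X) <= B.
    have := dot_ge_norm hdot (x k.+1) X.
    have : `|x k.+1| ^+ 2 <= 2 * (`|Y| ^+ 2 + `|z| ^+ 2).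
      have := parallelogram hdot Y z; rewrite YE.
      by have := sqr_ge0 `|Y - z|; lra.
    by rewrite /B; lra.
  have [a_ge0 a_le1] := andP a1.
  have N0 := sqr_ge0 `|v|; have NV0 := sqr_ge0 `|V|.
  have var_pos : var k <= pos k by rewrite le_max lexx orbT.
  have varle : pos k.+1 <= a * pos k + 2 * `|v| ^+ 2 + B * c k.+1.
    have e1 : 0 <= a * pos k by rewrite mulr_ge0.
    have e2 : 0 <= B * c k.+1 by rewrite mulr_ge0.
    rewrite ge_max; apply/andP; split; first by lra.
    rewrite var1.
    have := ler_wpM2l a_ge0 hv; have := ler_wpM2l a_ge0 var_pos.
    have := ler_wpM2l c1 hx1; rewrite var0.
    (* Since [a <= 1], the [|V|^2] of [hV] absorbs the one of [hv], so only the older velocity [v]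
       remains. *)
    have : 0 <= (1 - a) * (2 * `|v| ^+ 2 + `|V| ^+ 2).
      by rewrite mulr_ge0//; lra.
    by lra.
  have := ler_wpM2l (ltW sp) varle.
  have -> : s k.+1 * (a * pos k + 2 * `|v| ^+ 2 + B * c k.+1) =
      (s k.+1 - alpha) * pos k + 2 * s k.+1 * `|v| ^+ 2 + B * (s k.+1 * c k.+1).
    by rewrite -sa; ring.
  have : 0 <= (s k - b - (s k.+1 - alpha)) * pos k.
    apply: mulr_ge0 => //. by move: m_gt0; lra.
  (* Shifts the weight of [|v|^2] from [s k.+1] to [s k], as in [velocity_sum]; hence the factor
     4. *)
  have : 0 <= (2 * s k - s k.+1) * `|v| ^+ 2.
    by apply: mulr_ge0 => //; move: b_gt0 m_gt0; lra.
  by lra.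
have : near_summable ((fun k => 4 * (s k * `|x k.+1 - x k| ^+ 2)) \+
    (fun k => B * (s k.+1 * c k.+1))).
  apply: near_summableD; apply: near_summableZ => //; first exact: velocity_sum.
  exact: near_summableS c_sum.
move=> [W hW]; have bi : 0 <= b^-1 by rewrite invr_ge0 ltW.
have : near_summable (fun k => b * pos k).
  exists (fun k => s k * pos k + W k); near=> k.
  have s0 : 0 <= s k by near: k; exact: s_unbounded.
  have [W0 /= dW] : 0 <= W k /\ ((fun k => 4 * (s k * `|x k.+1 - x k| ^+ 2)) \+
    (fun k => B * (s k.+1 * c k.+1))) k <= W k - W k.+1 by near: k.
  have dk : b * pos k <= s k * pos k - s k.+1 * pos k.+1 +
    (4 * (s k * `|x k.+1 - x k| ^+ 2) + B * (s k.+1 * c k.+1)) by near: k.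
  by have := mulr_ge0 s0 (pos0 k); split; lra.
move=> /(near_summableZ bi); apply: near_summable_le.
by near=> k; rewrite mulKf// gt_eqF.
Unshelve. all: by end_near.
Qed.

End FixedMinimizer.

Theorem inertial_prox_weakly_converges : argmin f !=set0 ->
  exists2 xbar, argmin f xbar & weakly_converges dot x xbar.
Proof.
move=> fmin; apply: (opial hdot) => // [z|w xw]; first exact: distance_cvg.
have [z zmin] := fmin.
by apply: (argmin_convex_limit hdot) xw => //; exact: value_cvg.
Qed.

End Inertial.

(** * Growth of powers *)

Section PowerSequences.
Context (R : realType).
Implicit Types q r A : R.

(** Uses [ln (1 + 1/x) <= 1/x], then [e^u - 1 <= u e^u], which is [1 - u <= e^(-u)] multiplied by
    [e^u]. *)
Lemma powR_addn1_le (x r : R) : 0 < x -> 0 <= r ->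
  (x + 1) `^ r <= x `^ r + x `^ r * (r / x * expR (r / x)).
Proof.
move=> x0 r0; have x1 : 0 < x + 1 by rewrite addr_gt0.
have xr := powR_ge0 x r.
have -> : (x + 1) `^ r = x `^ r * expR (r * ln (1 + x^-1)).
  have -> : 1 + x^-1 = (x + 1) / x by field; rewrite gt_eqF.
  by rewrite /powR !gt_eqF// -expRD ln_div//; congr expR; ring.
rewrite -[X in _ <= X + _]mulr1 -mulrDr ler_wpM2l//.
have l1 : r * ln (1 + x^-1) <= r / x.
  rewrite ler_wpM2l// le_ln1Dx//.
  by rewrite (lt_le_trans _ (ltW (_ : 0 < _)))// invr_gt0.
apply: (@le_trans _ _ (expR (r / x))); first by rewrite ler_expR.
have := expR_ge1Dx (- (r / x)).
rewrite -(ler_pM2r (expR_gt0 (r / x))) -expRD addNr expR0.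
by lra.
Qed.

(** Convexity of the power [q^-1], applied to the midpoint of [x^q] and [y^q]. *)
Lemma powR_midconcave (x y q : R) : 0 <= x -> 0 <= y -> 0 < q <= 1 ->
  x `^ q + y `^ q <= 2 * ((x + y) / 2) `^ q.
Proof.
move=> x0 y0 /andP[q0 q1].
have qi : 1 <= q^-1 by rewrite invf_ge1.
have m0 : 0 <= 2^-1 * (x `^ q + y `^ q) by rewrite mulr_ge0 ?addr_ge0 ?powR_ge0.
have : 2^-1 * (x `^ q + y `^ q) <= ((x + y) / 2) `^ q; last by lra.
rewrite -[leLHS]powRr1// -[X in _ `^ X <= _](mulVf (lt0r_neq0 q0)) powRrM.
apply: (ge0_ler_powR (ltW q0)); rewrite ?nnegrE ?powR_ge0 ?divr_ge0 ?addr_ge0//.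
have h01 : 0 <= (2^-1 : R) <= 1 by lra.
have := convex_powR qi (@Itv01 R 2^-1 (andP h01).1 (andP h01).2).
move=> /(_ (x `^ q) (y `^ q)); rewrite !inE /= !in_itv /= !andbT.
move=> /(_ (powR_ge0 _ _) (powR_ge0 _ _)).
rewrite [X in X `^ _ <= _ -> _]convRE [X in _ <= X -> _]convRE /=.
rewrite -!powRrM mulfV ?gt_eqF// !powRr1//.
have -> : unstable.onem (2^-1 : R) = 2^-1 by rewrite /unstable.onem; field.
by rewrite -!mulrDr (mulrC 2^-1 (x + y)).
Qed.

Lemma near_powR_ge q A : 0 < q -> \forall k \near \oo, A <= k%:R `^ q.
Proof.
move=> q0; pose B := Num.max A 0; have B0 : 0 <= B by rewrite le_max lexx orbT.
near=> k; apply: (@le_trans _ _ B); first by rewrite le_max lexx.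
have -> : B = (B `^ q^-1) `^ q by rewrite -powRrM mulVf ?gt_eqF// powRr1.
apply: (ge0_ler_powR (ltW q0)); rewrite ?nnegrE ?powR_ge0//.
near: k; exact: nbhs_infty_ger.
Unshelve. all: by end_near.
Qed.

Lemma powRN_cvg0 r : 0 < r -> k%:R `^ (- r) @[k --> \oo] --> (0 : R).
Proof.
move=> r0; apply/cvgr0Pnorm_le => e e0; near=> k.
have h : e^-1 <= k%:R `^ r by near: k; exact: near_powR_ge.
have k0 : 0 < k%:R `^ r by apply: lt_le_trans h; rewrite invr_gt0.
by rewrite ger0_norm ?powR_ge0// powRN -[leRHS]invrK lef_pV2 ?posrE ?invr_gt0.
Unshelve. all: by end_near.
Qed.

Lemma expR_divn_cvg1 r : expR (r / k%:R) @[k --> \oo] --> (1 : R).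
Proof.
have r0 : r / k%:R @[k --> \oo] --> (0 : R).
  rewrite -(mulr0 r); apply: cvgMl_tmp.
  under eq_fun do rewrite -powR_inv1//.
  exact: powRN_cvg0.
have := cvg_comp _ _ r0 (@continuous_expR R 0).
by rewrite expR0.
Qed.

End PowerSequences.

(** * Increments of [k^q] and of the energy weights *)

Section PowerRates.
Context (R : realType) (alpha b sigma q delta : R).
Context (q_gt0 : 0 < q) (q_le1 : q <= 1) (delta_ge0 : 0 <= delta).
Context (sigma_ge0 : 0 <= sigma).
Context (sigma_cvg : k%:R `^ (q - 1) @[k --> \oo] --> sigma).
Context (b_lb : (2 * q + delta) * sigma < b) (b_ub : b < alpha - q * sigma).

Let s k : R := k%:R `^ q.

Lemma powRn_concave k : s k.+2 - s k.+1 <= s k.+1 - s k.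
Proof.
have := @powR_midconcave R k%:R k.+2%:R q; rewrite !ler0n q_gt0 q_le1.
move=> /(_ isT isT isT); have -> : (k%:R + k.+2%:R) / 2 = k.+1%:R :> R.
  by rewrite -(natr1 k.+1) -(natr1 k); field.
by rewrite /s; lra.
Qed.

Lemma powRn_nondecreasing k : s k <= s k.+1.
Proof.
by apply: (ge0_ler_powR (ltW q_gt0)); rewrite ?nnegrE ?ler0n// ler_nat.
Qed.

(* Comes from [(1 + 1/k)^r - 1 <= (r/k) e^(r/k)], multiplied by [k^q]. *)
Let rate r k : R := r * k%:R `^ (q - 1) * expR (r / k%:R).

Lemma rate_cvg r : rate r @ \oo --> r * sigma.
Proof.
rewrite -[r * sigma]mulr1; apply: cvgM; last exact: expR_divn_cvg1.
exact: cvgMl_tmp.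
Qed.

Lemma powRn_growth r k : (0 < k)%N -> 0 <= r ->
  s k * (k.+1%:R `^ r - k%:R `^ r) <= k%:R `^ r * rate r k.
Proof.
move=> k0 r0; have kp : 0 < k%:R :> R by rewrite ltr0n.
have := powR_addn1_le kp r0; rewrite natr1 -lerBlDl => h.
apply: le_trans (ler_wpM2l (powR_ge0 _ _) h) _.
rewrite /rate powRB ?(gt_eqF kp) ?implybT// powRr1//.
by rewrite /s; lra.
Qed.

Lemma powRn_step_le k : (0 < k)%N -> s k.+1 - s k <= rate q k.
Proof.
move=> k0; have kp : 0 < k%:R :> R by rewrite ltr0n.
have sp : 0 < s k by exact: powR_gt0.
rewrite -(ler_pM2l sp); exact: (powRn_growth k0 (ltW q_gt0)).
Qed.

Lemma powRn_step_near (e : R) : q * sigma < e ->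
  \forall k \near \oo, s k.+1 - s k <= e.
Proof.
move=> he; near=> k; apply: (@le_trans _ _ (rate q k)).
  by apply: powRn_step_le; near: k; exact: nbhs_infty_gt.
by near: k; exact: (cvgr_le _ (@rate_cvg q) _ he).
Unshelve. all: by end_near.
Qed.

(** With [K_k = k^(q + delta)], the difference divided by [l] is [(K_(k+1) - K_k)(s_(k+2) - alpha) +
    K_k (s_(k+2) - s_(k+1))], at most [K_k * (rate r k + rate q k)]. The sum of the rates tends to
    [(2 q + delta) sigma < b]. *)
Lemma powRn_weight_slow (l : R) : 0 < l -> \forall k \near \oo,
  s k.+1 * (s k.+2 - alpha) * (l * k.+1%:R `^ delta)
    - s k * (s k.+1 - alpha) * (l * k%:R `^ delta) <=
  b * (s k * (l * k%:R `^ delta)).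
Proof.
move=> l0; pose r := q + delta.
have r0 : 0 <= r by rewrite addr_ge0 ?(ltW q_gt0).
(* Two successive increments of [s] then sum to at most [alpha], so that [s k.+2 - alpha <= s k]. *)
have bs : q * sigma < alpha / 2.
  have := mulr_ge0 (ltW q_gt0) sigma_ge0; have := mulr_ge0 delta_ge0 sigma_ge0.
  by move: b_lb b_ub; lra.
near=> k.
have k0 : (0 < k)%N by near: k; exact: nbhs_infty_gt.
have hr : rate r k + rate q k <= b.
  near: k; apply: (cvgr_le _ (cvgD (@rate_cvg r) (@rate_cvg q))).
  by move: b_lb; rewrite /r; lra.
have ha : s k.+1 - s k <= alpha / 2 by near: k; exact: powRn_step_near.
have hc := powRn_concave k; have hq := powRn_step_le k0.
have sE j : (0 < j)%N -> s j * j%:R `^ delta = j%:R `^ r.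
  move=> j0; rewrite /r powRD// ?implybT//.
  by rewrite pnatr_eq0 -lt0n j0 implybT.
have -> : s k.+1 * (s k.+2 - alpha) * (l * k.+1%:R `^ delta) =
    l * ((s k.+1 * k.+1%:R `^ delta) * (s k.+2 - alpha)) by ring.
have -> : s k * (s k.+1 - alpha) * (l * k%:R `^ delta) =
    l * ((s k * k%:R `^ delta) * (s k.+1 - alpha)) by ring.
have -> : b * (s k * (l * k%:R `^ delta)) = l * (b * (s k * k%:R `^ delta)).
  by ring.
rewrite !sE// -mulrBr ler_pM2l//.
have g := powRn_growth k0 r0.
have Kr0 : 0 <= k%:R `^ r :> R by exact: powR_ge0.
have Kr : k%:R `^ r <= k.+1%:R `^ r :> R.
  by apply: (ge0_ler_powR r0); rewrite ?nnegrE ?ler0n// ler_nat.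
have h1 : (k.+1%:R `^ r - k%:R `^ r) * (s k.+2 - alpha) <=
    (k.+1%:R `^ r - k%:R `^ r) * s k.
  by apply: ler_wpM2l; [rewrite subr_ge0|lra].
have h2 : k%:R `^ r * (s k.+2 - s k.+1) <= k%:R `^ r * rate q k.
  by apply: ler_wpM2l => //; lra.
have := ler_wpM2l Kr0 hr; lra.
Unshelve. all: by end_near.
Qed.

End PowerRates.

(** * Application to power sequences *)

Lemma inertial_prox_powers (R : realType) (H : completeNormedModType R)
    (dot : {dot H for (@idfun R)}) (hdot : induces_norm dot)
    (f : H -> \bar R) (fproper : proper_fun f) (fconvex : convex_efun f)
    (flsc : lower_semicontinuous f) (fargmin : argmin f !=set0)
    (alpha b sigma q c p lambda delta : R) (c_gt0 : 0 < c)
    (lambda_gt0 : 0 < lambda) (q01 : 0 < q <= 1) (delta_ge0 : 0 <= delta)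
    (qp : q + 1 < p) (sigma_ge0 : 0 <= sigma)
    (sigma_cvg : k%:R `^ (q - 1) @[k --> \oo] --> sigma)
    (b_gt0 : 0 < b) (b_lb : (2 * q + delta) * sigma < b)
    (b_ub : b < alpha - q * sigma) (x : nat -> H)
    (hx : forall k : nat, (1 <= k)%N -> x k.+1 =
      prox (lambda * k%:R `^ delta) f (x k
        + (1 - alpha / k%:R `^ q) *: (x k - x k.-1)
        - (c / k%:R `^ p) *: x k)) :
  exists2 xbar : H, argmin f xbar & weakly_converges dot x xbar.
Proof.
have [q_gt0 q_le1] := andP q01.
(* Half of the slack in [b_ub], so that [alpha - b - m] still exceeds the limit bound [q * sigma] of
   the increments. *)
pose m := (alpha - q * sigma - b) / 2.
have m_gt0 : 0 < m by rewrite /m; lra.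
apply: (@inertial_prox_weakly_converges R H dot hdot f fproper fconvex flsc
  alpha b m lambda (fun k => k%:R `^ q) (fun k => c / k%:R `^ p)
  (fun k => lambda * k%:R `^ delta)) => //.
- by move=> A; exact: near_powR_ge.
- near=> k; rewrite powRn_concave// andbT subr_ge0; exact: powRn_nondecreasing.
- apply: (powRn_step_near q_gt0 sigma_cvg); rewrite /m; lra.
- near=> k; rewrite ler_peMr ?(ltW lambda_gt0)//.
  have k1 : 1 <= k%:R :> R by rewrite ler1n; near: k; exact: nbhs_infty_gt.
  by have := ler_powR k1 delta_ge0; rewrite powRr0.
- exact: (powRn_weight_slow q_gt0 q_le1 delta_ge0 sigma_ge0 sigma_cvg b_lb b_ub).
- by near=> k; rewrite divr_ge0 ?powR_ge0// ltW.
- have pq : 1 < p - q by lra.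
  apply: near_summable_le (near_summableZ (ltW c_gt0) (near_summable_powRN pq)).
  near=> k; have k0 : k%:R != 0 :> R.
    by rewrite pnatr_eq0 -lt0n; near: k; exact: nbhs_infty_gt.
  by rewrite opprB powRB ?k0 ?implybT// mulrCA.
- near=> k; apply: hx; near: k; exact: nbhs_infty_ge.
Unshelve. all: by end_near.
Qed.

Theorem theorem2p4 (R : realType) (H : completeNormedModType R)
    (dot : {dot H for (@idfun R)}) (hdot : induces_norm dot)
    (f : H -> \bar R) (fproper : proper_fun f) (fconvex : convex_efun f)
    (flsc : lower_semicontinuous f) (fargmin : argmin f !=set0)
    (alpha q c p lambda delta : R) (c_gt0 : 0 < c) (lambda_gt0 : 0 < lambda)
    (hparam :
      [/\ 0 < alpha, 0 < q < 1, 0 <= delta, q + 1 < p <= 2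
        & p = 2 -> q * (1 - q) < c]
      \/ [/\ q = 1, 2 < p, 3 < alpha & 0 <= delta < alpha - 3])
    (x : nat -> H)
    (hx : forall k : nat, (1 <= k)%N ->
      let alpha_k := 1 - alpha / k%:R `^ q in
      let c_k := c / k%:R `^ p in
      let lambda_k := lambda * k%:R `^ delta in
      x k.+1 = prox lambda_k f
        (x k + alpha_k *: (x k - x k.-1) - c_k *: x k)) :
  exists2 xbar : H, argmin f xbar & weakly_converges dot x xbar.
Proof.
case: hparam => [[alpha_gt0 /andP[q_gt0 q_lt1] delta_ge0 /andP[qp _] _]
                |[q1 p2 alpha3 /andP[delta_ge0 delta_lt]]].
(* Here [sigma = 0], and [b] is the midpoint of the admissible interval []0, alpha[]. *)
- apply: (@inertial_prox_powers R H dot hdot f fproper fconvex flsc fargmin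
    alpha (alpha / 2) 0 q c p lambda delta) => //; try lra.
  by rewrite -opprB; apply: powRN_cvg0; rewrite subr_gt0.
(* Here [sigma = 1], and [b] is the midpoint of []2 + delta, alpha - 1[], nonempty because
   [delta < alpha - 3]. *)
- apply: (@inertial_prox_powers R H dot hdot f fproper fconvex flsc fargmin
    alpha ((alpha + 1 + delta) / 2) 1 q c p lambda delta) => //;
    rewrite ?q1; try lra.
  by rewrite subrr; under eq_fun do rewrite powRr0; exact: cvg_cst.
Qed.
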